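(* For every fixed edge-ordered graph $G$ with at least one edge, $ssat_e(n,G)=O(n\log n)$.
   Context: An edge-ordered graph is a finite simple graph together with a linear order on its edge set (usually given by an injective labeling $l:E\to\mathbb{N}$ or $l:E\to\mathbb{R}$). A copy of $G$ in an edge-ordered graph $H$ is a subgraph of $H$ (with the induced edge-order) isomorphic to $G$ by an isomorphism respecting the edge-order. $ssat_e(n,G)$ is the minimum number of edges in an edge-ordered graph $H$ on $n$ vertices (not required to be $G$-free) such that adding to $H$ any missing edge, inserted at an arbitrary position of the linear order of the edges, creates a new copy of $G$ (one using the added edge); that is, for every missing edge and every position a new copy is created. Asymptotic notation is for $n\to\infty$ with $G$ fixed; the implied constant may depend on $G$. *)

(* Defs.v *)
From mathcomp Require Import all_boot.
From mathcomp Require Import boolp.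

Set Implicit Arguments.
Unset Strict Implicit.
Unset Printing Implicit Defensive.

(* Edges are two-element vertex sets.  The relation [ele] is only meaningful
   on [edges]; its values on other pairs of sets are irrelevant. *)
Record eograph (V : finType) := EOGraph {
  edges : {set {set V}};
  ele : rel {set V};
  edges_card2 : {in edges, forall e : {set V}, #|e| = 2};
  ele_anti : {in edges &, antisymmetric ele};
  ele_trans : {in edges & &, transitive ele};
  ele_total : {in edges &, total ele}
}.

Section Copies.
Variables V W : finType.

(* The subgraph with vertex set S and edge set F is isomorphic to G, through
   an isomorphism phi, when it is ordered by the restriction of [ele H]. *)
Definition is_copy (G : eograph V) (H : eograph W)
    (S : {set W}) (F : {set {set W}}) : Prop :=
  F \subset edges H /\
  exists phi : V -> W,
    [/\ injective phi,
        phi @: [set: V] = S,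
        [set phi @: (e : {set V}) | e in edges G] = F
      & {in edges G &, forall e f : {set V},
          ele H (phi @: e) (phi @: f) = ele G e f}].

Definition missing_edge (H : eograph W) (e : {set W}) : Prop :=
  #|e| = 2 /\ e \notin edges H.

(* As H' varies, the linear order of H' runs over all possible insertions of e
   into the linear order of H. *)
Definition adds_edge (H : eograph W) (e : {set W}) (H' : eograph W) : Prop :=
  edges H' = e |: edges H /\ {in edges H &, ele H' =2 ele H}.

Definition semisaturated (G : eograph V) (H : eograph W) : Prop :=
  forall (e : {set W}) (H' : eograph W),
    missing_edge H e -> adds_edge H e H' ->
    exists (S : {set W}) (F : {set {set W}}), is_copy G H' S F /\ e \in F.

End Copies.

Section CompleteGraph.
Variable V : finType.

Let cedges : {set {set V}} := [set e : {set V} | #|e| == 2].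
Let cle : rel {set V} := fun e f => enum_rank e <= enum_rank f.

Fact complete_card2 : {in cedges, forall e : {set V}, #|e| = 2}.
Proof. by move=> e; rewrite inE => /eqP. Qed.

Fact complete_anti : {in cedges &, antisymmetric cle}.
Proof.
move=> e f _ _; rewrite /cle -eqn_leq => /eqP ef.
by apply: enum_rank_inj; apply: val_inj.
Qed.

Fact complete_trans : {in cedges & &, transitive cle}.
Proof. by move=> f e g _ _ _; apply: leq_trans. Qed.

Fact complete_total : {in cedges &, total cle}.
Proof. by move=> e f _ _; apply: leq_total. Qed.

Definition complete_eograph : eograph V :=
  EOGraph complete_card2 complete_anti complete_trans complete_total.

End CompleteGraph.

Definition semisat_size (V : finType) (n : nat) (G : eograph V) : pred nat :=
  fun m =>
    `[< exists H : eograph 'I_n, semisaturated G H /\ #|edges H| = m >].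

Lemma semisat_size_ex (V : finType) (n : nat) (G : eograph V) :
  exists m, semisat_size n G m.
Proof.
exists #|edges (complete_eograph 'I_n)|; apply/asboolP.
exists (complete_eograph 'I_n); split=> // e H' [e2].
by rewrite inE e2 eqxx.
Qed.

Definition ssat_e (V : finType) (n : nat) (G : eograph V) : nat :=
  ex_minn (semisat_size_ex n G).

(* Main.v *)
Require Import Defs.
From mathcomp Require Import all_boot all_order all_algebra.
From mathcomp Require Import all_classical all_reals all_analysis.
From mathcomp Require Import zify.
Import Order.TTheory GRing.Theory Num.Theory.
Import numFieldNormedType.Exports.
Local Open Scope classical_set_scope.
Local Open Scope ring_scope.

(* Let m_0 and m_1 be the largest and the smallest edge of G.  Give every
   vertex of H a code of about log n bits, all codes being distinct, and
   reserve pairwise disjoint cores C(i,s), one for each bit i and s in {0,1},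
   each a set of vertices indexed by V.  The edges of H are all the pairs that
   meet a core, O(n log n) in number.  With respect to C(i,s), a vertex outside
   the cores plays one end of m_s or the other according to the i-th bit of its
   code, and an edge meeting C(i,s) is labeled by s and by the rank in G of the
   edge that it plays; all edges with s = 0 precede all edges with s = 1.  A
   missing edge uv joins two vertices outside the cores, whose codes differ in
   some bit i; so u, v and C(i,s) carry G minus m_s, in the right order.  A new
   edge is below all edges with s = 1 or above all edges with s = 0, and thus
   can play m_1 or m_0. *)

(** * Edge ranks, orders induced by labels, and order-preserving copies *)

Section EdgeOrder.
Local Open Scope set_scope.
Local Open Scope nat_scope.
Context {V : finType} (G : eograph V).

Definition edge_rank (h : {set V}) : nat :=
  #|[set g in edges G | ele G g h]|.

Lemma ele_edge_rank :
  {in edges G &, forall g h, ele G g h = (edge_rank g <= edge_rank h)}.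
Proof.
have mono g h : g \in edges G -> h \in edges G -> ele G g h ->
    [set f in edges G | ele G f g] \subset [set f in edges G | ele G f h].
  move=> gE hE gh; apply/fintype.subsetP => f; rewrite !inE => /andP[fE fg].
  by rewrite fE (ele_trans gE fE hE fg gh).
move=> g h gE hE; apply/idP/idP => [gh|].
  exact/subset_leq_card/mono.
apply: contraTT => Ngh; rewrite -ltnNge; apply: proper_card.
have hg : ele G h g by have := ele_total hE gE; rewrite (negbTE Ngh) orbF.
rewrite properE mono //=; apply/fintype.subsetPn; exists g; rewrite !inE gE.
  by have := ele_total gE gE; rewrite orbb.
exact: Ngh.
Qed.

Lemma edge_rank_le h : edge_rank h <= #|edges G|.
Proof.
by apply/subset_leq_card/fintype.subsetP => g; rewrite inE => /andP[].
Qed.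

Lemma edge_max_ex : 0 < #|edges G| ->
  exists2 m, m \in edges G & {in edges G, forall g, ele G g m}.
Proof.
case/card_gt0P => m0 m0E; case: (arg_maxnP edge_rank m0E) => m mE mmax.
by exists m => // g gE; rewrite ele_edge_rank //; apply: mmax.
Qed.

Lemma edge_min_ex : 0 < #|edges G| ->
  exists2 m, m \in edges G & {in edges G, forall g, ele G m g}.
Proof.
case/card_gt0P => m0 m0E; case: (arg_minnP edge_rank m0E) => m mE mmin.
by exists m => // g gE; rewrite ele_edge_rank //; apply: mmin.
Qed.

Lemma eograph_of_label (E : {set {set V}}) (lab : {set V} -> nat) :
    {in E, forall e : {set V}, #|e| = 2} ->
  exists2 H : eograph V, edges H = E &
    forall e f, lab e < lab f -> ele H f e = false.
Proof.
(* Ties between labels are broken by [enum_rank], which stays below [#|{set V}|]. *)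
move=> E2; pose key e := lab e * #|{set V}| + enum_rank e.
have keyI : injective key.
  move=> e f ef; apply/enum_rank_inj/val_inj => /=.
  have := congr1 (modn^~ #|{set V}|) ef.
  by rewrite /key !modnMDl !modn_small // ltn_ord.
have anti : {in E &, antisymmetric (fun e f => key e <= key f)}.
  by move=> e f _ _; rewrite -eqn_leq => /eqP /keyI.
have trans : {in E & &, transitive (fun e f => key e <= key f)}.
  by move=> f e g _ _ _; apply: leq_trans.
have tot : {in E &, total (fun e f => key e <= key f)}.
  by move=> e f _ _; apply: leq_total.
exists (EOGraph E2 anti trans tot) => //= e f ef.
apply/negbTE; rewrite -ltnNge /key.
apply: leq_trans (leq_trans (leq_mul ef (leqnn _)) (leq_addr _ _)).
by rewrite mulSn addnC ltn_add2r.
Qed.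

(** Totality of the order of [H] and antisymmetry of that of [G] turn preservation of strict
    inequalities into an equivalence. *)
Lemma is_copy_strict {W : finType} (H : eograph W) (phi : V -> W) :
    injective phi -> {in edges G, forall g, phi @: (g : {set V}) \in edges H} ->
    {in edges G &, forall g h, ele G h g = false ->
      ele H (phi @: (h : {set V})) (phi @: (g : {set V})) = false} ->
  is_copy G H (phi @: [set: V])
    [set phi @: (g : {set V}) | g in edges G].
Proof.
move=> phiI phiE strict; split.
  by apply/fintype.subsetP => _ /imsetP[g /phiE ? ->].
exists phi; split=> // g h gE hE; case gh: (ele G g h); last exact: strict.
have [-> | gNh] := eqVneq g h.
  by have := ele_total (phiE _ hE) (phiE _ hE); rewrite orbb.
have hg : ele G h g = false.
  by apply: contraNF gNh => hg; apply/eqP/(ele_anti gE hE); rewrite gh.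
have := ele_total (phiE _ gE) (phiE _ hE).
by rewrite (strict g h gE hE hg) orbF.
Qed.

End EdgeOrder.

(** * Semisaturated graphs with few edges *)

Section Construction.
Local Open Scope set_scope.
Local Open Scope nat_scope.

Lemma card_injection (A B : finType) : #|A| <= #|B| ->
  exists f : A -> B, injective f.
Proof.
move=> AB; exists (fun x => enum_val (widen_ord AB (enum_rank x))).
by move=> x y /enum_val_inj /(congr1 val) /= /val_inj /enum_rank_inj.
Qed.

Lemma card_pairs_image {A B C : finType} (f : A -> B -> C) (E : {set C}) :
  (forall e, e \in E -> exists x y, e = f x y) -> #|E| <= #|A| * #|B|.
Proof.
move=> Ef; rewrite -card_prod.
apply: leq_trans (leq_imset_card (fun p => f p.1 p.2) predT).
apply/subset_leq_card/fintype.subsetP => e /Ef[x [y ->]].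
by apply/imsetP; exists (x, y).
Qed.

(** [c (i, s, _)] enumerates the core C(i,s). Every edge of [H] pairs a core vertex with some
    vertex, whence the bound. *)
Lemma semisaturated_cores {V W I : finType} (G : eograph V)
    (c : I * bool * V -> W) (code : W -> {ffun I -> bool}) :
    0 < #|edges G| -> injective c -> injective code ->
  exists2 H : eograph W, semisaturated G H &
    #|edges H| <= #|{: I * bool * V}| * #|W|.
Proof.
move=> G0 cI codeI.
have [m0 m0E m0max] := edge_max_ex G G0.
have [m1 m1E m1min] := edge_min_ex G G0.
pose m s := if s then m1 else m0.
have mE s : m s \in edges G by case: s.
have [ab mab] : exists ab : bool -> V * V, forall s,
    (ab s).1 != (ab s).2 /\ m s = [set (ab s).1; (ab s).2].
  have /cards2P[a0 [b0 [d0 e0]]] : #|m0| == 2 by rewrite (edges_card2 m0E).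
  have /cards2P[a1 [b1 [d1 e1]]] : #|m1| == 2 by rewrite (edges_card2 m1E).
  by exists (fun s => if s then (a1, b1) else (a0, b0)); case.
(* [role i s] is meant to invert the embedding [phi s] below, for any missing edge whose ends are
   told apart by bit [i]. *)
pose role i s x := if [pick t | c t == x] is Some t then t.2
  else if code x i then (ab s).1 else (ab s).2.
(* Larger than every rank: labels with s = 0 are below [M], those with s = 1 are not. *)
pose M := #|edges G|.+1.
(* The choice of t matters only for edges between distinct cores, which no copy
   uses. *)
pose lab (e : {set W}) := if [pick t | c t \in e] is Some (i, s, _)
  then s * M + edge_rank G (role i s @: e) else 0.
pose E := [set e : {set W} | (#|e| == 2) && [exists t, c t \in e]].
have E2 : {in E, forall e : {set W}, #|e| = 2}.
  by move=> e; rewrite inE => /andP[/eqP].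
have [H HE Hlt] := eograph_of_label E lab E2.
exists H; last first.
  rewrite HE; apply: (card_pairs_image (fun t x => [set c t; x])) => e.
  rewrite inE => /andP[/cards2P[x [y [_ ->]]] /existsP[t]].
  rewrite !inE => /orP[] /eqP <-; exists t.
    by exists y.
  by exists x; rewrite finset.setUC.
move=> e H' [e2 eNH] [H'E H'le].
have eC t : c t \notin e.
  by apply: contra eNH => te; rewrite HE inE e2 eqxx; apply/existsP; exists t.
have [i [u [v [eE ui vi]]]] : exists i u v,
    [/\ e = [set u; v], code u i & ~~ code v i].
  have /cards2P[u [v [uv eE]]] : #|e| == 2 by rewrite e2.
  have [i] : exists i, code u i != code v i.
    apply/existsP; apply: contraNT uv; rewrite negb_exists => /forallP uv.
    by apply/eqP/codeI/ffunP => i; apply/eqP; have := uv i; rewrite negbK.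
  case ui: (code u i); case vi: (code v i) => // _; exists i.
    by exists u, v; rewrite ui vi.
  by exists v, u; rewrite finset.setUC ui vi.
have uv : u != v by apply: contraNneq vi => <-.
have uC t : c t != u by apply: contraNneq (eC t) => ->; rewrite eE !inE eqxx.
have vC t : c t != v.
  by apply: contraNneq (eC t) => ->; rewrite eE !inE eqxx orbT.
pose phi s w := if w == (ab s).1 then u
  else if w == (ab s).2 then v else c (i, s, w).
have phiK s : cancel (phi s) (role i s).
  move=> w; rewrite /phi /role; case: eqVneq => [->|_].
    by case: pickP => [t|_]; rewrite ?(negbTE (uC t)) ?ui.
  case: eqVneq => [->|_].
    by case: pickP => [t|_]; rewrite ?(negbTE (vC t)) ?(negbTE vi).
  by case: pickP => [t /eqP/cI -> //|/(_ (i, s, w))]; rewrite eqxx.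
have phim s : phi s @: m s = e.
  have [/negbTE ab12 ->] := mab s; rewrite imsetU1 imset_set1 /phi !eqxx.
  by rewrite eq_sym ab12 eE.
(* An edge other than [m s] has a vertex off [m s], which goes to C(i,s). As [u] and [v] lie in no
   core, the label of the image is read from that core. *)
have phiE s (g : {set V}) : g \in edges G -> g != m s ->
    phi s @: g \in E /\ lab (phi s @: g) = s * M + edge_rank G g.
  move=> gE gm; have [w wg /norP[wa wb]] : exists2 w, w \in g &
      ~~ ((w == (ab s).1) || (w == (ab s).2)).
    have /fintype.subsetPn[w wg] : ~~ (g \subset m s).
      apply: contra gm => gm; rewrite eqEcard gm.
      by rewrite (edges_card2 gE) (edges_card2 (mE s)).
    by have [_ ->] := mab s; rewrite !inE; exists w.
  have ct : c (i, s, w) \in phi s @: g.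
    by apply/imsetP; exists w; rewrite // /phi (negbTE wa) (negbTE wb).
  split.
    rewrite inE card_imset; last exact: can_inj (phiK s).
    by rewrite (edges_card2 gE) eqxx; apply/existsP; exists (i, s, w).
  rewrite /lab; case: pickP => [[[j r] x]|/(_ (i, s, w))]; last by rewrite ct.
  case/imsetP => y _; rewrite /phi; case: eqP => [_ /eqP|_].
    by rewrite (negbTE (uC _)).
  case: eqP => [_ /eqP|_ /cI[-> -> _]]; first by rewrite (negbTE (vC _)).
  by rewrite -imset_comp (eq_imset (g := id)) ?imset_id // => z; apply: phiK.
have H'E' f : f \in E -> f \in edges H'.
  by move=> fE; rewrite H'E HE finset.setU1r.
have eH' : e \in edges H' by rewrite H'E finset.setU11.
(* If some edge labeled below [M] is above [e], then [e] is below all edges labeled [M] or more and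
   plays [m1]. Otherwise [e] is above all edges labeled below [M] and plays [m0]. *)
have [s es] : exists s, {in edges G, forall g, g != m s ->
    if s then ele H' (phi s @: (g : {set V})) e = false
    else ele H' e (phi s @: (g : {set V})) = false}.
  have [/existsP[f /and3P[fE flab ef]] | ] :=
    boolP [exists f, [&& f \in E, lab f < M & ele H' e f]].
    exists true => g gE /(phiE _ _ gE)[gH glab].
    apply/negP => ge; have := ele_trans eH' (H'E' _ gH) (H'E' _ fE) ge ef.
    rewrite H'le ?HE // Hlt // glab mul1n.
    exact: leq_trans flab (leq_addr _ _).
  rewrite negb_exists => /forallP low.
  exists false => g gE /(phiE _ _ gE)[gH glab].
  have := low (phi false @: g); rewrite gH glab mul0n add0n ltnS.
  by rewrite edge_rank_le /= => /negbTE.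
exists (phi s @: [set: V]), [set phi s @: (g : {set V}) | g in edges G].
split; last by apply/imsetP; exists (m s).
apply: is_copy_strict; first exact: can_inj (phiK s).
  move=> g gE; have [-> | gm] := eqVneq g (m s); first by rewrite phim.
  by apply: H'E'; case: (phiE s g gE gm).
move=> g h gE hE hg.
(* When [g] or [h] is [m s], extremality of [m s] leaves only the comparison supplied by [es]. *)
have [gm | gm] := eqVneq g (m s).
  have hm : h != m s.
    apply: contraFneq hg => ->; rewrite gm.
    by have := ele_total (mE s) (mE s); rewrite orbb.
  move: hg (es h hE hm); rewrite gm phim; case: (s) => //.
  by rewrite (m0max _ hE).
have [hm | hm] := eqVneq h (m s).
  move: hg (es g gE gm); rewrite hm phim; case: (s) => //.
  by rewrite (m1min _ gE).
have [gH glab] := phiE s g gE gm; have [hH hlab] := phiE s h hE hm.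
rewrite H'le ?HE // Hlt // glab hlab ltn_add2l ltnNge.
by rewrite -(ele_edge_rank G) // hg.
Qed.

Lemma ssat_e_le {V : finType} {n : nat} {G : eograph V} {H : eograph 'I_n} :
  semisaturated G H -> ssat_e n G <= #|edges H|.
Proof.
move=> GH; rewrite /ssat_e; case: ex_minnP => k _; apply.
by apply/asboolP; exists H.
Qed.

(** [l] bits give the [n] vertices distinct codes, and the cores take up [l * 2 * #|V|] vertices in
    all. *)
Lemma ssat_e_log (V : finType) (G : eograph V) (n l : nat) :
    0 < #|edges G| -> n <= 2 ^ l ->
  ssat_e n G <= l * 2 * #|V| * n.
Proof.
move=> G0 nl; have cardT : #|{: 'I_l * bool * V}| = l * 2 * #|V|.
  by rewrite !card_prod card_ord card_bool.
have [Tn | nT] := leqP #|{: 'I_l * bool * V}| #|'I_n|.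
  have [c cI] := card_injection _ _ Tn.
  have [|code codeI] := card_injection 'I_n {ffun 'I_l -> bool}.
    by rewrite card_ffun card_bool !card_ord.
  have [H GH] := semisaturated_cores G c code G0 cI codeI.
  by rewrite cardT card_ord; apply/leq_trans/ssat_e_le.
(* The complete graph is small enough when the cores do not fit in 'I_n. *)
have complete : semisaturated G (complete_eograph 'I_n).
  by move=> e H' [e2]; rewrite inE e2 eqxx.
apply: leq_trans (ssat_e_le complete) _.
have : #|edges (complete_eograph 'I_n)| <= #|'I_n| * #|'I_n|.
  apply: (card_pairs_image (fun x y => [set x; y])) => e.
  by rewrite inE => /cards2P[x [y [_ ->]]]; exists x, y.
move=> /leq_trans; apply; rewrite -cardT {2}card_ord.
exact: leq_mul (ltnW nT) (leqnn _).
Qed.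

End Construction.

(** * The asymptotic bound *)

Lemma trunc_log2_ln (R : realType) (n : nat) : (0 < n)%N ->
  (trunc_log 2 n)%:R * ln 2 <= ln n%:R :> R.
Proof.
move=> n0; rewrite mulr_natl -lnXn // ler_ln ?posrE ?exprn_gt0 ?ltr0n //.
by rewrite -natrX ler_nat trunc_logP.
Qed.

Theorem corollary11 (R : realType) (V : finType) (G : eograph V)
    (hG : (0 < #|edges G|)%N) :
  (fun n : nat => (ssat_e n G)%:R : R)
    =O_\oo (fun n : nat => n%:R * ln (n%:R : R)).
Proof.
have ln2 : 0 < ln 2 :> R by rewrite ln_gt0 // ltr1n.
(* For n >= 2, [(trunc_log 2 n).+1] is at most twice [trunc_log 2 n], which turns the factor 2 into
   4. Dividing by [ln 2] changes the base of the logarithm, and the successor gives positivity. *)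
apply/eqO_exP; exists ((4 * #|V|).+1%:R / ln 2); first by rewrite divr_gt0.
near=> n.
have n2 : (2 <= n)%N by near: n; exists 2%N.
have n0 : (0 < n)%N by apply: ltnW.
have tn : (0 < trunc_log 2 n)%N by rewrite trunc_log_gt0.
have lnn : 0 <= ln n%:R :> R by rewrite ln_ge0 // ler1n.
rewrite !ger0_norm ?mulr_ge0 //.
have bound : (ssat_e n G <= (4 * #|V|).+1 * (n * trunc_log 2 n))%N.
  apply: leq_trans (ssat_e_log V G n (trunc_log 2 n).+1 hG _) _.
    exact/ltnW/trunc_log_ltn.
  nia.
apply: (@le_trans _ _ ((4 * #|V|).+1 * (n * trunc_log 2 n))%:R).
  by rewrite ler_nat.
rewrite natrM -mulrA ler_wpM2l // natrM mulrCA ler_wpM2l //.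
by rewrite mulrC ler_pdivlMr // trunc_log2_ln.
Unshelve. all: by end_near.
Qed.
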